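(* Let $U$ be a fixed set. An object $\mathcal{H}_C$ of the category $\mathbf{Sset(U)}$ of soft sets over $U$ is a separator if and only if $\mathcal{H}_C$ is a null soft set with $C\neq\emptyset$.
   Context: Let $U$ be a fixed universal set. A soft set $\mathcal{F}_A$ over $U$ consists of a set $A$ (the parameter set, an arbitrary set, possibly empty) together with a function $\mathcal{F}:A\to\mathcal{P}(U)$, where $\mathcal{P}(U)$ is the power set of $U$. The soft set $\mathcal{F}_A$ is a null soft set if $\mathcal{F}(a)=\emptyset$ for all $a\in A$. A soft morphism from a soft set $\mathcal{F}_A$ to a soft set $\mathcal{G}_B$ is a function $\alpha:A\to B$ such that $\mathcal{F}(a)\subseteq(\mathcal{G}\circ\alpha)(a)$ for each $a\in A$; formally it is regarded as the triple $(\mathcal{F}_A,\alpha,\mathcal{G}_B)$. Composition is composition of functions and the identity soft morphism is the identity function. $\mathbf{Sset(U)}$ is the category whose objects are all soft sets over $U$ and whose morphisms are the soft morphisms. An object $S$ of a category is a separator if whenever $f,g:X\to Y$ are distinct morphisms, there exists a morphism $h:S\to X$ such that $f\circ h\neq g\circ h$. *)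

(* Defs.v *)
From mathcomp Require Import all_boot.
From mathcomp Require Import boolp classical_sets.

Set Implicit Arguments.
Unset Strict Implicit.
Unset Printing Implicit Defensive.

Local Open Scope classical_set_scope.

Record category := Category {
  obj : Type;
  hom : obj -> obj -> Type;
  idm : forall X, hom X X;
  compm : forall X Y Z, hom Y Z -> hom X Y -> hom X Z;
  compmA : forall X Y Z W (f : hom Z W) (g : hom Y Z) (h : hom X Y),
    compm f (compm g h) = compm (compm f g) h;
  comp1m : forall X Y (f : hom X Y), compm (idm Y) f = f;
  compm1 : forall X Y (f : hom X Y), compm f (idm X) = f
}.

Arguments hom {c} X Y.
Arguments idm {c} X.
Arguments compm {c X Y Z} f g.

Definition separator (C : category) (S : obj C) : Prop :=
  forall (X Y : obj C) (f g : hom X Y), f <> g ->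
    exists h : hom S X, compm f h <> compm g h.

(* The parameter set is an arbitrary, possibly empty, type; it is part of the
   data of the soft set, while the universe [U] is fixed. *)
Record soft_set (U : Type) := SoftSet {
  param : Type;
  soft_val : param -> set U
}.

Arguments soft_val {U} s a.

Definition null_soft_set (U : Type) (F : soft_set U) : Prop :=
  forall a : param F, soft_val F a = set0.

(* Source and target are type indices, so the triple (F, alpha, G) is an element
   of [soft_morphism F G]; as the inclusion is a proposition, two parallel
   morphisms are equal iff their underlying functions are ([soft_morphism_eq]). *)
Record soft_morphism (U : Type) (F G : soft_set U) := SoftMorphism {
  soft_fun : param F -> param G;
  soft_funP : forall a : param F, soft_val F a `<=` soft_val G (soft_fun a)
}.

Arguments soft_funP {U F G} _ a.

Lemma soft_morphism_eq (U : Type) (F G : soft_set U) (f g : soft_morphism F G) :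
  soft_fun f = soft_fun g <-> f = g.
Proof.
split=> [|-> //]; case: f g => [f fP] [g gP] /= efg.
by case: g / efg gP => gP; congr SoftMorphism; exact: Prop_irrelevance.
Qed.

Definition soft_id (U : Type) (F : soft_set U) : soft_morphism F F :=
  @SoftMorphism U F F id (fun a => @subset_refl U (soft_val F a)).

Definition soft_comp (U : Type) (F G H : soft_set U)
    (g : soft_morphism G H) (f : soft_morphism F G) : soft_morphism F H :=
  @SoftMorphism U F H (soft_fun g \o soft_fun f)
    (fun a => subset_trans (soft_funP f a) (soft_funP g (soft_fun f a))).

Lemma soft_compA (U : Type) (F G H K : soft_set U) (f : soft_morphism H K)
    (g : soft_morphism G H) (h : soft_morphism F G) :
  soft_comp f (soft_comp g h) = soft_comp (soft_comp f g) h.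
Proof. exact/soft_morphism_eq. Qed.

Lemma soft_comp1m (U : Type) (F G : soft_set U) (f : soft_morphism F G) :
  soft_comp (soft_id G) f = f.
Proof. exact/soft_morphism_eq. Qed.

Lemma soft_compm1 (U : Type) (F G : soft_set U) (f : soft_morphism F G) :
  soft_comp f (soft_id F) = f.
Proof. exact/soft_morphism_eq. Qed.

Definition Sset (U : Type) : category :=
  @Category (soft_set U) (@soft_morphism U) (@soft_id U) (@soft_comp U)
    (@soft_compA U) (@soft_comp1m U) (@soft_compm1 U).

(* Main.v *)
Require Import Defs.
From mathcomp Require Import all_boot.
From mathcomp Require Import boolp classical_sets.

Set Implicit Arguments.
Unset Strict Implicit.

(** The two maps from the null soft set on a point to the null soft set on two
    points are distinct. A morphism into the point separating them forces its
    source to be null, and its source to have a parameter, since there is only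
    one function out of the empty set. Conversely, a constant map out of a null
    soft set is always a soft morphism, so it can select a parameter at which
    two given morphisms differ. *)

Local Open Scope classical_set_scope.

Definition null_on (U A : Type) : soft_set U := @SoftSet U A (fun=> set0).

Definition null_map (U A : Type) (G : soft_set U) (phi : A -> param G) :
    soft_morphism (null_on U A) G :=
  @SoftMorphism U (null_on U A) G phi (fun a => sub0set (soft_val G (phi a))).

(** Kept transparent so that its [soft_fun] computes to the constant map at [x]. *)
Definition null_const (U : Type) (H G : soft_set U) (nullH : null_soft_set H)
    (x : param G) : soft_morphism H G.
Proof.
by apply: (@SoftMorphism U H G (fun=> x)) => a; rewrite nullH; exact: sub0set.
Defined.

(** Each value of [H] lies inside a value of [G], which is empty. *)
Lemma null_of_morphism (U : Type) (H G : soft_set U) :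
  null_soft_set G -> soft_morphism H G -> null_soft_set H.
Proof.
move=> nullG h a; rewrite -subset0 -(nullG (soft_fun h a)).
exact: soft_funP.
Qed.

Lemma param_nonempty_of_neq (U : Type) (H G : soft_set U)
    (f g : soft_morphism H G) : f <> g -> [set: param H] !=set0.
Proof.
move=> neq_fg; apply: contrapT => H0; apply: neq_fg.
apply/soft_morphism_eq/funext => a; case: H0; by exists a.
Qed.

Theorem theorem4 (U : Type) (H : soft_set U) :
  @separator (Sset U) H <-> null_soft_set H /\ [set: param H] !=set0.
Proof.
split=> [sepH | [nullH [c _]] X Y f g neq_fg].
  pose pt (b : bool) : soft_morphism (null_on U unit) (null_on U bool) :=
    @null_map U unit (null_on U bool) (fun=> b).
  have neq_pt : pt true <> pt false.
    by move=> /soft_morphism_eq /(congr1 (@^~ tt)).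
  have [h neq_h] := sepH _ _ _ _ neq_pt.
  (* The distinct parallel morphisms out of [H] are the two composites with [h]. *)
  split; last exact: param_nonempty_of_neq neq_h.
  exact: (null_of_morphism _ h).
have [x neq_x] : exists x, soft_fun f x <> soft_fun g x.
  apply: contrapT => all_eq; apply: neq_fg.
  by apply/soft_morphism_eq/funext; apply/not_forallP.
(* Nonemptiness enters here: at [c] the two composites take the values of [f] and [g] at [x]. *)
exists (null_const nullH x) => /soft_morphism_eq /(congr1 (@^~ c)).
exact: neq_x.
Qed.
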